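(* Let $y_n=n$ for $n\ge1$. Then its output array is the Catalan triangle, i.e. $A(n,k)=\frac{n-k+1}{n+1}\binom{n+k}{k}$ for $0\le k\le n$ and $A(n,k)=0$ for $k>n$, and for $n\ge3$: $$W(n)=C_{n+1}=\frac{1}{n+2}\binom{2n+2}{n+1},\quad T(n)=\frac{n+2}{2n+1},\quad M(n)=\frac{(n+2)(5n-7)}{4(2n+1)(2n-1)},\quad S(n)=\frac{3(n-3)(n-2)}{4(2n+1)(2n-1)}.$$ Consequently $\lim_{n\to\infty}T(n)=\frac12$, $\lim_{n\to\infty}M(n)=\frac5{16}$, $\lim_{n\to\infty}S(n)=\frac3{16}$.
   Context: For a nondecreasing sequence $(y_n)_{n\ge1}$ of positive integers and a positive integer $n$, an $n$-tuple $(x_1,\dots,x_n)$ of nonnegative integers is valid if $x_1\le y_n$ and $x_{j+1}\le\min(x_j,y_{n-j})$ for $1\le j\le n-1$. $A(n,k)$ is the number of valid $n$-tuples with $x_1=k$, and $W(n)=\sum_{k=0}^{y_n}A(n,k)$. For $n\ge3$ define $$T(n)=\frac{(1+y_n-y_{n-1})W(n-1)}{W(n)},\qquad M(n)=\frac{\sum_{k=1}^{(y_{n-1}-y_{n-2})+1}\big(W(n-1)-kW(n-2)\big)}{W(n)},\qquad S(n)=1-M(n)-T(n).$$ $C_m=\frac{1}{m+1}\binom{2m}{m}$ denotes the $m$-th Catalan number. *)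

(* Defs.v *)
From HB Require Import structures.
From mathcomp Require Import all_boot all_order all_algebra.
From mathcomp Require Import all_classical all_reals all_analysis.

Set Implicit Arguments.
Unset Strict Implicit.
Unset Printing Implicit Defensive.

Import Order.TTheory GRing.Theory Num.Theory.
Import numFieldNormedType.Exports.

Local Open Scope ring_scope.

(* Sequences (y_n)_{n >= 1} are functions y : nat -> nat; the value y 0 is    *)
(* not used by valid, outA, outW when n >= 1, nor by outT, outM, outS when    *)
(* n >= 3. The names outA, outW, outT, outM, outS stand for A, W, T, M, S     *)
(* (a bare S would shadow the successor constructor of nat).                  *)

(* The entry x_j of an n-tuple, with indices starting at 1. *)
Definition entry (n : nat) (x : n.-tuple nat) (j : nat) : nat :=
  nth 0%N x j.-1.

Definition valid (y : nat -> nat) (n : nat) (x : n.-tuple nat) : bool :=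
  ((entry x 1 <= y n) &&
   [forall j : 'I_n, (1 <= j) ==>
      (entry x j.+1 <= minn (entry x j) (y (n - j)))])%N.

(* The entries of a valid n-tuple are all at most y n, so counting valid      *)
(* tuples over the finite type n.-tuple 'I_(y n).+1 below loses none.         *)
Lemma valid_bounded (y : nat -> nat) (n : nat) (x : n.-tuple nat) :
  valid y x -> all (fun v => v <= y n)%N x.
Proof.
case/andP=> h1 /forallP h; apply/(all_nthP 0%N) => i.
rewrite size_tuple; elim: i => [|i IH] ltin; first exact: h1.
have /implyP/(_ isT) := h (Ordinal ltin).
rewrite /entry /= leq_min => /andP[le_i _].
exact: leq_trans le_i (IH (ltnW ltin)).
Qed.

Definition outA (y : nat -> nat) (n k : nat) : nat :=
  #|[set t : n.-tuple 'I_(y n).+1 |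
      let x := [tuple of map val t] in valid y x && (entry x 1 == k)]|.

Definition outW (y : nat -> nat) (n : nat) : nat :=
  (\sum_(0 <= k < (y n).+1) outA y n k)%N.

Definition outT (R : realType) (y : nat -> nat) (n : nat) : R :=
  (1 + (y n)%:R - (y (n - 1)%N)%:R) * (outW y (n - 1)%N)%:R / (outW y n)%:R.

(* The upper bound uses truncated subtraction, which is exact since y is      *)
(* nondecreasing; the summands are subtracted in R.                           *)
Definition outM (R : realType) (y : nat -> nat) (n : nat) : R :=
  (\sum_(1 <= k < ((y (n - 1) - y (n - 2)) + 1).+1%N)
      ((outW y (n - 1)%N)%:R - k%:R * (outW y (n - 2)%N)%:R)) / (outW y n)%:R.

Definition outS (R : realType) (y : nat -> nat) (n : nat) : R :=
  1 - outM R y n - outT R y n.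

Definition catalan (R : realType) (m : nat) : R :=
  (m.+1)%:R^-1 * 'C(2 * m, m)%:R.

(* Main.v *)
Require Import Defs.
From HB Require Import structures.
From mathcomp Require Import all_boot all_order all_algebra.
From mathcomp Require Import all_classical all_reals all_analysis.
From mathcomp Require Import ring lra zify.

Set Implicit Arguments.
Unset Strict Implicit.
Unset Printing Implicit Defensive.

Import Order.TTheory GRing.Theory Num.Theory.
Import numFieldNormedType.Exports.

Local Open Scope classical_set_scope.
Local Open Scope ring_scope.

(* A valid tuple is determined by its first entry x_1 = k and a shorter valid
   tuple whose first entry is at most k, so the size B n k of the set of valid
   n-tuples with all entries at most k satisfies, for y n = n, the recurrence
   B (n+1) (k+1) = B (n+1) k + B n (k+1) of the ballot numbers, which gives
   B n (k+1) = C(n+k+2, k+1) - C(n+k+2, k).  Then A(n+1, k) = B n k and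
   W(n) = B n (n+1) is a Catalan number, and T and M are expressed through
   the ratio of consecutive Catalan numbers. *)

(** * Valid tuples as lists, for arbitrary [y] *)

Section ValidSequences.
Variable y : nat -> nat.

(* The bound on an entry depends only on the length of the suffix it starts. *)
Fixpoint valid_below (b : nat) (s : seq nat) : bool :=
  if s is x :: s' then (x <= minn b (y (size s)))%N && valid_below x s'
  else true.

(** For [y n = n], the length of this list is the number [B n b]. *)
Fixpoint valid_seqs (n b : nat) : seq (seq nat) :=
  if n is m.+1 then
    [seq x :: s | x <- iota 0 (minn b (y n)).+1, s <- valid_seqs m x]
  else [:: [::]].

Lemma mem_valid_seqs n b s :
  (s \in valid_seqs n b) = (size s == n) && valid_below b s.
Proof.
elim: n b s => [|n IHn] b [|x s]; rewrite ?inE //.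
- by apply/allpairsPdep => -[? [? []]].
apply/idP/idP => [/allpairsPdep[x' [s' [+ + [-> ->]]]]|].
  rewrite mem_iota IHn /= eqSS => le_x /andP[/eqP-> ->].
  by rewrite andbT eqxx.
move=> /andP[/eqP[sz_s] /andP[le_x val_s]].
apply/allpairsPdep; exists x, s; split=> //.
  by rewrite mem_iota -sz_s.
by rewrite IHn sz_s eqxx.
Qed.

Lemma valid_seqs_uniq n b : uniq (valid_seqs n b).
Proof.
elim: n b => [|n IHn] b //.
apply: allpairs_uniq_dep => [|x _|]; [exact: iota_uniq | exact: IHn |].
by move=> [x s] [x' s'] _ _ /= [-> ->].
Qed.

Lemma size_valid_seqsS n b :
  size (valid_seqs n.+1 b) =
  (\sum_(0 <= x < (minn b (y n.+1)).+1) size (valid_seqs n x))%N.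
Proof. by rewrite size_allpairs_dep sumnE big_map /index_iota subn0. Qed.

(** Prepending [b] makes the cap on the first entry one more instance of the chain condition, so the
    recursive test becomes the indexed one used in [valid]. *)
Lemma valid_belowP b s :
  reflect (forall j, (j < size s)%N ->
             (nth 0 (b :: s) j.+1 <= minn (nth 0 (b :: s) j) (y (size s - j)))%N)
          (valid_below b s).
Proof.
elim: s b => [|x s IHs] b /=; first by apply: ReflectT.
apply: (iffP andP) => [[le_x /IHs val_s] [|j]|val_s].
- by move=> _; rewrite subn0.
- by rewrite ltnS subSS => /val_s.
split; first by have := val_s 0%N isT; rewrite subn0.
by apply/IHs => j ltj; have := val_s j.+1 ltj; rewrite subSS.
Qed.

Lemma valid_head n (x : n.+1.-tuple nat) :
  valid y x = (head 0 x <= y n.+1)%N && valid_below (head 0 x) (behead x).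
Proof.
case/tupleP: x => a s; rewrite /valid /entry /=.
have sz_s : size s = n by rewrite size_tuple.
congr andb; apply/forallP/valid_belowP => [h j|h [[|j] ltj]] //=.
  (* Index [j] of the tail is index [j.+1] of the tuple; index 0 is vacuous in [valid]. *)
  rewrite sz_s => ltj; have := h (inord j.+1).
  by rewrite inordK //= subSS.
by have := h j; rewrite sz_s subSS => -> //.
Qed.

(** Deleting the head [k] is a bijection onto the shorter lists capped by [k]; both sides are
    compared as duplicate-free lists. *)
Lemma outA_valid_seqs n k : (k <= y n.+1)%N ->
  outA y n.+1 k = size (valid_seqs n k).
Proof.
move=> le_k; rewrite /outA cardE.
pose f (t : n.+1.-tuple 'I_(y n.+1).+1) : seq nat := map val t.
have f_inj : injective f.
  by move=> t t' /(inj_map val_inj) /val_inj.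
rewrite -(size_map f) -(size_map (cons k) (valid_seqs n k)).
apply/perm_size/uniq_perm.
- by rewrite map_inj_uniq // enum_uniq.
- by rewrite map_inj_uniq ?valid_seqs_uniq // => s s' [].
move=> s; apply/mapP/mapP => [[t]|[s' + ->]].
  rewrite mem_enum inE => /andP[val_t /eqP hd_t] ->.
  move: val_t hd_t; rewrite valid_head /f.
  case/tupleP: t => a t; rewrite /entry /= => /andP[_ val_t] ak.
  exists (map val t); rewrite ?ak //.
  by rewrite mem_valid_seqs size_map size_tuple eqxx -ak.
rewrite mem_valid_seqs => /andP[sz_s' val_s'].
have sz : size (k :: s') == n.+1 by [].
have val_x : valid y (Tuple sz) by rewrite valid_head /= le_k.
have /allP le_x := valid_bounded val_x.
(* [valid_bounded] puts every entry in the range where [inord] is faithful. *)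
have fK : map val (map (fun v => inord v : 'I_(y n.+1).+1) (k :: s')) = k :: s'.
  rewrite -map_comp -[RHS]map_id; apply/eq_in_map => v /le_x le_v /=.
  by rewrite inordK.
exists [tuple of map (fun v => inord v : 'I_(y n.+1).+1) (Tuple sz)] => //.
rewrite mem_enum inE; apply/andP; split.
  suff -> : [tuple of map val [tuple of map (fun v => inord v : 'I_(y n.+1).+1)
    (Tuple sz)]] = Tuple sz by [].
  exact: val_inj.
by rewrite /entry /= inordK.
Qed.

Lemma outA_eq0 n k : (y n.+1 < k)%N -> outA y n.+1 k = 0%N.
Proof.
move=> lt_k; apply: eq_card0 => t; rewrite inE; apply/negbTE/negP.
case/andP => /andP[le_x _] /eqP eq_x.
by rewrite eq_x leqNgt lt_k in le_x.
Qed.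

Lemma outW_valid_seqs n b : (y n.+1 <= b)%N ->
  outW y n.+1 = size (valid_seqs n.+1 b).
Proof.
move=> le_b; rewrite size_valid_seqsS (minn_idPr le_b) /outW.
by apply: eq_big_nat => k; rewrite ltnS => /outA_valid_seqs.
Qed.

End ValidSequences.

(** * The ballot recurrence for [y n = n] *)

Section Staircase.
Variables (y : nat -> nat) (hy : forall n : nat, (1 <= n)%N -> y n = n).

Lemma size_staircase0 n : size (valid_seqs y n 0) = 1%N.
Proof.
elim: n => // n IHn.
by rewrite size_valid_seqsS min0n big_nat1.
Qed.

(** With [b < n.+1] the minimum never truncates, so raising the cap to [b.+1] only adds the lists
    that start with [b.+1]. *)
Lemma size_staircaseS n b : (b <= n)%N ->
  size (valid_seqs y n.+1 b.+1) =
  (size (valid_seqs y n.+1 b) + size (valid_seqs y n b.+1))%N.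
Proof.
move=> le_b; rewrite !size_valid_seqsS hy //.
rewrite !(minn_idPl _) ?ltnS // 1?leqW //.
by rewrite (big_nat_recr b.+1).
Qed.

Lemma size_staircase_max n :
  size (valid_seqs y n.+1 n.+2) = size (valid_seqs y n.+1 n.+1).
Proof. by rewrite !size_valid_seqsS hy // minnn (minn_idPr _). Qed.

(* The subtracted binomial is moved to the left to avoid truncated
   subtraction in nat. *)
Lemma size_staircase_bin n k : (k <= n)%N ->
  (size (valid_seqs y n k.+1) + 'C(n + k.+2, k) = 'C(n + k.+2, k.+1))%N.
Proof.
elim: n k => [|n IHn] k; first by case: k.
elim: k => [|k IHk] le_k.
  rewrite size_staircaseS // size_staircase0 bin0 bin1.
  by have := IHn 0%N isT; rewrite bin0 bin1; lia.
have := IHk (ltnW le_k).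
rewrite !addSn !addnS !binS; move: le_k; rewrite leq_eqVlt => /predU1P[[eq_k]|lt_k].
  rewrite {}eq_k size_staircase_max.
  have := @bin_sub (n + n).+3 n.+1 ltac:(lia).
  have -> : ((n + n).+3 - n.+1 = n.+2)%N by lia.
  rewrite !binS; lia.
rewrite (@size_staircaseS n k.+1) //.
(* Off the diagonal, Pascal's rule matches the recurrence. *)
have := IHn k.+1 lt_k; rewrite !addnS !binS; lia.
Qed.

End Staircase.

(** * Closed forms and limits via Catalan ratios *)

Section Catalan.
Variable R : realType.

Lemma catalan_gt0 n : 0 < catalan R n.
Proof.
rewrite /catalan mulr_gt0 // ?invr_gt0 ?ltr0n // bin_gt0; lia.
Qed.

Lemma catalanS n :
  (n%:R + 2) * catalan R n.+1 = 2 * (2 * n%:R + 1) * catalan R n.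
Proof.
have bin_rec : (n.+1 * 'C(2 * n.+1, n.+1) = 2 * (2 * n + 1) * 'C(2 * n, n))%N.
  (* C(2n+2, n+1) and C(2n, n) are linked through C(2n+1, n). *)
  have e1 := mul_bin_diag (2 * n).+2 n.
  have e2 := mul_bin_down (2 * n).+1 n.
  have -> : (2 * n.+1 = (2 * n).+2)%N by lia.
  have e3 : ((2 * n).+1 - n = n.+1)%N by lia.
  rewrite e3 /= in e2; rewrite -e1 /=; nia.
move/(congr1 (fun m => m%:R : R)): bin_rec.
rewrite /catalan /= -[n.+2]addn2 -[n.+1]addn1 !(natrM, natrD) => e.
have n0 : 0 <= n%:R :> R by exact: ler0n.
have n1_neq0 : n%:R + 1 != 0 :> R by lra.
have n2_neq0 : n%:R + 2 != 0 :> R by lra.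
apply: (mulfI n1_neq0).
rewrite [X in _ * X = _]mulrA mulfV // mul1r e; field.
by [].
Qed.

Lemma catalan_alt n :
  catalan R n.+1 = 1 / (n%:R + 2) * 'C(2 * n + 2, n + 1)%:R.
Proof.
rewrite /catalan div1r -[n.+2]addn2 natrD addn1.
by have -> : (2 * n.+1 = 2 * n + 2)%N by lia.
Qed.

Variables (y : nat -> nat) (hy : forall n : nat, (1 <= n)%N -> y n = n).

Lemma size_staircase_ratio n k : (k <= n)%N ->
  (size (valid_seqs y n k.+1))%:R =
    (n%:R - k%:R + 1) / (n%:R + 2) * 'C(n + k.+2, k.+1)%:R :> R.
Proof.
move=> le_k.
have := congr1 (fun m => m%:R : R) (size_staircase_bin hy le_k).
rewrite /= natrD => e1.
(* With N = n+k+2, (n+2) C(N, k) = (k+1) C(N, k+1) merges the two binomials into a multiple of C(N,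
   k+1). *)
have := congr1 (fun m => m%:R : R) (mul_bin_left (n + k.+2) k).
have -> : (n + k.+2 - k = n + 2)%N by lia.
rewrite /= !natrM -[X in X%:R * _]addn1 !natrD => e2.
have n2_neq0 : n%:R + 2 != 0 :> R.
  have n0 : 0 <= n%:R :> R by exact: ler0n.
  lra.
apply: (mulfI n2_neq0); rewrite mulrA mulrCA mulfV // mulr1.
have -> : (size (valid_seqs y n k.+1))%:R =
          'C(n + k.+2, k.+1)%:R - 'C(n + k.+2, k)%:R :> R by rewrite -e1 addrK.
rewrite mulrBr -e2; ring.
Qed.

Lemma outA_staircase n k : (1 <= n)%N -> (k <= n)%N ->
  (outA y n k)%:R =
    (n%:R - k%:R + 1) / (n%:R + 1) * 'C(n + k, k)%:R :> R.
Proof.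
case: n => // n _ le_k.
have n0 : 0 <= n%:R :> R by exact: ler0n.
rewrite outA_valid_seqs ?hy //; case: k le_k => [_|k le_k].
  rewrite size_staircase0 bin0 -addn1 natrD; field; lra.
rewrite size_staircase_ratio // addSnnS -(natr1 n) -(natr1 k).
congr (_ / _ * _); ring.
Qed.

Lemma outW_staircase n : (1 <= n)%N -> (outW y n)%:R = catalan R n.+1.
Proof.
case: n => // n _.
(* The cap [n.+2], one above [y n.+1], is the case [k = n.+1] of [size_staircase_ratio], whose
   numerator is 1. *)
rewrite (outW_valid_seqs (b := n.+2)) ?hy //.
rewrite size_staircase_ratio // catalan_alt.
have -> : (n.+1 + n.+3 = 2 * n.+1 + 2)%N by lia.
by rewrite subrr add0r addn1.
Qed.

Lemma catalan_ratio n :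
  catalan R n / catalan R n.+1 = (n%:R + 2) / (2 * (2 * n%:R + 1)).
Proof.
have n0 : 0 <= n%:R :> R by exact: ler0n.
have c_neq0 : catalan R n.+1 != 0 by rewrite gt_eqF ?catalan_gt0.
have d_neq0 : 2 * (2 * n%:R + 1) != 0 :> R by lra.
by apply/eqP; rewrite eqr_div // catalanS mulrC.
Qed.

Lemma outT_staircase n : (3 <= n)%N ->
  outT R y n = (n%:R + 2) / (2 * n%:R + 1).
Proof.
case: n => // n le3n; have n_gt0 : (0 < n)%N by lia.
rewrite /outT subn1 /= !outW_staircase ?hy //.
rewrite -mulrA catalan_ratio -[n.+1]addn1 natrD.
have n0 : 0 <= n%:R :> R by exact: ler0n.
field; lra.
Qed.

Lemma outM_staircase n : (3 <= n)%N ->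
  outM R y n = (n%:R + 2) * (5 * n%:R - 7)
                 / (4 * (2 * n%:R + 1) * (2 * n%:R - 1)).
Proof.
case: n => [|[|n]] // le3n; have n_gt0 : (0 < n)%N by lia.
rewrite /outM subn1 subn2 /= !hy // subSnn !outW_staircase //.
(* Consecutive [y] differ by 1, so the sum has just the terms k = 1 and k = 2. *)
rewrite addn1 unlock /= addr0 mul1r.
have c_neq0 : catalan R n.+3 != 0 by rewrite gt_eqF ?catalan_gt0.
have c'_neq0 : catalan R n.+2 != 0 by rewrite gt_eqF ?catalan_gt0.
(* Both smaller Catalan numbers become rational multiples of [catalan R n.+3], which then
   cancels. *)
rewrite -[catalan R n.+1](divfK c'_neq0) catalan_ratio.
rewrite -[catalan R n.+2](divfK c_neq0) catalan_ratio.
have : 3 <= n.+2%:R :> R by rewrite ler_nat.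
rewrite -!natr1; move: (n%:R) (catalan R n.+3) c_neq0 => x c c_neq0 x1.
field; lra.
Qed.

Lemma outS_staircase n : (3 <= n)%N ->
  outS R y n = 3 * (n%:R - 3) * (n%:R - 2)
                 / (4 * (2 * n%:R + 1) * (2 * n%:R - 1)).
Proof.
move=> le3n; rewrite /outS outM_staircase // outT_staircase //.
have : 3 <= n%:R :> R by rewrite ler_nat.
move: (n%:R) => x x3; field; lra.
Qed.

(** As [harmonic n] is 1/(n+1), this is the limit of a linear factor a(n+1) + b divided by n+1. *)
Lemma cvg_affine_harmonic (a b : R) :
  a + b * harmonic n @[n --> \oo] --> a.
Proof.
rewrite -[X in _ --> X]addr0; apply: cvgD; first exact: cvg_cst.
by rewrite -(mulr0 b); apply: cvgM; [exact: cvg_cst | exact: cvg_harmonic].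
Qed.

Lemma cvg_outT_staircase : outT R y n @[n --> \oo] --> (1 / 2 : R).
Proof.
have two_neq0 : 2 != 0 :> R by rewrite pnatr_eq0.
(* n+2 = (n+1) + 1 and 2n+1 = 2(n+1) - 1. *)
have cvg_f := cvgM (@cvg_affine_harmonic 1 1)
             (cvgV two_neq0 (@cvg_affine_harmonic 2 (-1))).
apply: cvg_trans (cvg_f _ _); apply: near_eq_cvg; near=> n.
have n3 : (3 <= n)%N by near: n; exact: nbhs_infty_ge.
rewrite outT_staircase //= -natr1.
have : 3 <= n%:R :> R by rewrite ler_nat.
move: (n%:R) => x x3; field; lra.
Unshelve. all: by end_near. Qed.

Lemma cvg_outM_staircase : outM R y n @[n --> \oo] --> (5 / 16 : R).
Proof.
have sixteen_neq0 : 8 * 2 != 0 :> R by rewrite mulf_neq0 ?pnatr_eq0.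
have -> : 5 / 16 = 1 * 5 / (8 * 2) :> R by field.
(* 5n-7 = 5(n+1) - 12, 4(2n+1) = 8(n+1) - 4 and 2n-1 = 2(n+1) - 3. *)
have cvg_f := cvgM (cvgM (@cvg_affine_harmonic 1 1) (@cvg_affine_harmonic 5 (-12)))
             (cvgV sixteen_neq0 (cvgM (@cvg_affine_harmonic 8 (-4))
                                      (@cvg_affine_harmonic 2 (-3)))).
apply: cvg_trans (cvg_f _ _ _ _); apply: near_eq_cvg; near=> n.
have n3 : (3 <= n)%N by near: n; exact: nbhs_infty_ge.
rewrite outM_staircase //= -natr1.
have : 3 <= n%:R :> R by rewrite ler_nat.
move: (n%:R) => x x3; field; lra.
Unshelve. all: by end_near. Qed.

Lemma cvg_outS_staircase : outS R y n @[n --> \oo] --> (3 / 16 : R).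
Proof.
have -> : 3 / 16 = 1 - 5 / 16 - 1 / 2 :> R by field.
apply: cvgB cvg_outT_staircase.
by apply: cvgB cvg_outM_staircase; exact: cvg_cst.
Qed.

End Catalan.

Theorem theorem6p4 (R : realType) (y : nat -> nat)
    (hy : forall n : nat, (1 <= n)%N -> y n = n) :
  [/\ (forall n k : nat, (1 <= n)%N -> (k <= n)%N ->
        (outA y n k)%:R =
          (n%:R - k%:R + 1) / (n%:R + 1) * 'C(n + k, k)%:R :> R),
      (forall n k : nat, (1 <= n)%N -> (n < k)%N -> outA y n k = 0%N),
      (forall n : nat, (3 <= n)%N ->
        [/\ (outW y n)%:R = catalan R n.+1 /\
            catalan R n.+1 =
              1 / (n%:R + 2) * 'C(2 * n + 2, n + 1)%:R,
            outT R y n = (n%:R + 2) / (2 * n%:R + 1),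
            outM R y n =
              (n%:R + 2) * (5 * n%:R - 7)
                / (4 * (2 * n%:R + 1) * (2 * n%:R - 1)) &
            outS R y n =
              3 * (n%:R - 3) * (n%:R - 2)
                / (4 * (2 * n%:R + 1) * (2 * n%:R - 1))]) &
      [/\ outT R y n @[n --> \oo] --> (1 / 2 : R),
          outM R y n @[n --> \oo] --> (5 / 16 : R) &
          outS R y n @[n --> \oo] --> (3 / 16 : R)]].
Proof.
split; first exact: outA_staircase.
- by case=> // n k _ lt_nk; rewrite outA_eq0 ?hy.
- move=> n le3n; split; last exact: outS_staircase.
  + by rewrite outW_staircase ?catalan_alt // ltnW // ltnW.
  + exact: outT_staircase.
  + exact: outM_staircase.
split; [exact: cvg_outT_staircase | exact: cvg_outM_staircase |].
exact: cvg_outS_staircase.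
Qed.
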